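(* Let $\mathbf{B}=(B;\le,0,1)$ be a bounded partially ordered set, let $S_{\mathbf B}$ be the set of maps $h_D\colon B\to\{0,1\}$ indexed by the down-sets $D$ of $\mathbf B$ with $0\in D$ and $1\notin D$, where $h_D(a)=0$ iff $a\in D$; identify each $b\in B$ with the map $S_{\mathbf B}\to\{0,1\}$, $h\mapsto b(h):=h(b)$ (so $\mathbf B$ is a bounded subposet of $2^{S_{\mathbf B}}$). Let $C\subseteq B$ with $1\in C$, ordered as in $\mathbf B$, and let $X$ be a non-empty set. For each $x\in X$ let $T_x\colon C\to 2^{S_{\mathbf B}}$ be an order-preserving map with $T_x(1)=1$, and put $T=(T_x)_{x\in X}$. Define, for each $x\in X$, $$R_{T_x}=\{(s,t)\in S_{\mathbf B}\times S_{\mathbf B}\mid \forall c\in C:\ T_x(c)(s)\le c(t)\},$$ let $R_T=\bigcup_{x\in X}\{x\}\times R_{T_x}$ (so $(X,S_{\mathbf B},R_T)$ is the upper $T$-induced automaton), and let $T_{R_T}=((T_{R_T})_x)_{x\in X}\colon B\to (2^{S_{\mathbf B}})^X$ be given by $(T_{R_T})_x(b)(s)=\bigwedge\{b(t)\mid (s,t)\in R_{T_x}\}$ (empty meet $=1$). Then for all $b\in C$ and all $x\in X$, $T_x(b)=(T_{R_T})_x(b)$, i.e. $T(b)=T_{R_T}(b)$.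
   Context: $2^{S_{\mathbf B}}$ denotes the set of maps $S_{\mathbf B}\to\{0,1\}$ ordered pointwise, with $0<1$; $p(s)$ denotes the value of such a map $p$ at $s$. A down-set of $\mathbf B$ is a subset $D$ with $a\le d\in D\Rightarrow a\in D$. *)

(* Defs.v *)
From mathcomp Require Export all_boot all_order all_classical.

Set Implicit Arguments.
Unset Strict Implicit.
Unset Printing Implicit Defensive.
Import Order.TTheory.
Local Open Scope classical_set_scope.
Local Open Scope order_scope.

Definition downset (d : Order.disp_t) (B : porderType d) (D : set B) : Prop :=
  forall a b : B, a <= b -> D b -> D a.

Definition h_ (d : Order.disp_t) (B : porderType d) (D : set B) : B -> bool :=
  fun a => a \notin D.

Definition states (d : Order.disp_t) (B : tbPOrderType d) : set (B -> bool) :=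
  [set h_ D | D in [set D | [/\ downset D, D \bot & ~ D \top]]].
Arguments states {d} B _.

(* The power 2^(S_B), with [bool] as 2 ([false] as 0, [true] as 1); its order
   [<=] is the library's pointwise order on functions. *)
Notation pow2 B := (states B -> bool).

Definition ident (d : Order.disp_t) (B : tbPOrderType d) (b : B) : pow2 B :=
  fun h => val h b.

Definition R_ (d : Order.disp_t) (B : tbPOrderType d) (C : set B)
    (T : C -> pow2 B) : set (states B * states B) :=
  [set st | forall c : C, T c st.1 <= ident (val c) st.2].

Definition upper_automaton (d : Order.disp_t) (B : tbPOrderType d) (C : set B)
    (X : Type) (T : X -> C -> pow2 B) : set (X * (states B * states B)) :=
  \bigcup_x ([set x] `*` R_ (T x)).

(* [infimum true A] is the meet of [A] in [bool], with empty meet [true]. *)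
Definition upper_op (d : Order.disp_t) (B : tbPOrderType d) (X : Type)
    (R : set (X * (states B * states B))) (b : B) : X -> pow2 B :=
  fun x s => infimum true [set ident b t | t in [set t | R (x, (s, t))]].

Lemma ident_le (d : Order.disp_t) (B : tbPOrderType d) (a b : B) :
  (ident a <= ident b) = (a <= b).
Proof.
apply/idP/idP => [/lefP ab|ab].
  apply/negPn/negP => nab.
  have Dh : h_ [set z | z <= b] \in states B.
    apply/mem_set; exists [set z | z <= b] => //; split => //=.
    - by move=> y z yz; exact: le_trans.
    - by move=> tb; move/negP: nab; apply; exact: le_trans (lex1 a) tb.
  have := ab (SigSub Dh); rewrite /ident /= /h_.
  by rewrite memNset ?mem_set //=; exact/negP.
apply/lefP => -[h hS]; rewrite /ident /=.
have [D [Dd _ _] <-] := set_mem hS.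
rewrite /h_; have [Db|nDb] := pselect (D b); last first.
  by rewrite (memNset nDb) lex1.
by rewrite (mem_set (Dd _ _ ab Db)) le0x.
Qed.

Lemma ident0 (d : Order.disp_t) (B : tbPOrderType d) :
  ident (\bot : B) = fun=> false.
Proof.
apply/funext => -[h hS]; rewrite /ident /=.
by have [D [_ D0 _] <-] := set_mem hS; apply/negbTE/negPn/mem_set.
Qed.

Lemma ident1 (d : Order.disp_t) (B : tbPOrderType d) :
  ident (\top : B) = fun=> true.
Proof.
apply/funext => -[h hS]; rewrite /ident /=.
by have [D [_ _ D1] <-] := set_mem hS; rewrite /h_ memNset.
Qed.

Lemma upper_opE (d : Order.disp_t) (B : tbPOrderType d) (C : set B)
    (X : Type) (T : X -> C -> pow2 B) (b : B) (x : X) (s : states B) :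
  upper_op (upper_automaton T) b x s =
  infimum true [set ident b t | t in [set t | R_ (T x) (s, t)]].
Proof.
suff E : [set t | upper_automaton T (x, (s, t))] =
         [set t | R_ (T x) (s, t)] by rewrite /upper_op E.
by apply/seteqP; split => t /=; [move=> [y _ [/= ->]]|exists x].
Qed.

Lemma infimum_trueP (A : set bool) : infimums A (infimum true A).
Proof.
rewrite /infimum; case: ifPn => [/eqP ->|/set0P [a Aa]].
  by split => [y []|y _]; rewrite lex1.
have [A0|A0] := pselect (A false); case: xgetP => [y _ //|].
  by move=> /(_ false)[]; split => [z _|z /(_ _ A0)//]; exact: le0x.
by move=> /(_ true)[]; split => [[] // /A0 //|z _]; exact: lex1.
Qed.

(* Main.v *)
(* If T_x(b)(s) = 1, the definition of R_{T_x} forces b(t) = 1 for all t related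
   to s.  If T_x(b)(s) = 0, then b <> 1, so the principal down-set of b is a
   state t with b(t) = 0; it is related to s, since c(t) = 0 means c <= b and so
   T_x(c)(s) <= T_x(b)(s) = 0 for c in C. *)

Require Import Defs.

Set Implicit Arguments.
Unset Strict Implicit.
Unset Printing Implicit Defensive.
Import Order.TTheory.
Local Open Scope classical_set_scope.
Local Open Scope order_scope.

Lemma h_below (d : Order.disp_t) (B : porderType d) (b a : B) :
  h_ [set z | z <= b] a = ~~ (a <= b).
Proof.
rewrite /h_; case: (boolP (a <= b)) => ab; first by rewrite mem_set.
by rewrite memNset //=; exact/negP.
Qed.

Lemma h_below_states (d : Order.disp_t) (B : tbPOrderType d) (b : B) :
  ~~ (\top <= b) -> h_ [set z | z <= b] \in states B.
Proof.
move=> b1; apply/mem_set; exists [set z | z <= b] => //; split => /=.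
- by move=> y z yz; exact: le_trans.
- exact: le0x.
- exact/negP.
Qed.

Theorem theorem4 (d : Order.disp_t) (B : tbPOrderType d)
    (C : set B) (C1 : C \top)
    (X : Type) (X0 : [set: X] !=set0)
    (T : X -> C -> pow2 B)
    (T_mono : forall (x : X) (c c' : C), val c <= val c' -> T x c <= T x c')
    (T1 : forall x : X, T x (SigSub (mem_set C1)) = fun=> true) :
  forall (b : C) (x : X),
    T x b = upper_op (upper_automaton T) (val b) x.
Proof.
move=> b x; apply/funext => s; rewrite upper_opE.
set A := [set _ | _ in _]; have [lbA glbA] := infimum_trueP A.
apply/le_anti/andP; split.
  (* The condition defining [R_ (T x)], taken at [c = b], makes [T x b s] a lower bound of [A]. *)
  by apply: glbA => _ [t Rt <-]; exact: Rt.
case Tbs: (T x b s); first exact: lex1.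
have T_below (c : C) : val c <= val b -> T x c s = false.
  by move=> /(T_mono x)/lefP/(_ s); rewrite Tbs; case: (T x c s).
have b1 : ~~ (\top <= val b).
  (* If [\top <= b], then [T_below] at [c = \top] would make T_x(1)(s) = 0, against T_x(1) = 1. *)
  by apply/negP => /(T_below (SigSub (mem_set C1))); rewrite T1.
(* The meet lies below every member of [A], so one related state at which [b] takes the value 0 is
   enough. *)
apply: lbA; exists (SigSub (h_below_states b1)).
  move=> c /=; rewrite /ident /= h_below.
  (* For [c <= b] the left side is 0; otherwise the right side is 1. *)
  case: (boolP (val c <= val b)) => [/T_below ->|_]; [exact: le0x|exact: lex1].
by rewrite /ident /= h_below lexx.
Qed.
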